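(* For every integer $n\ge 0$, every $s\in[1,\infty]$ and every $p\in[1,2)$, $W_n\in L^s(\mathbb{R})\cap W^{1,p}(\mathbb{R})$. For every integer $n\ge 1$, every $s\in(1,\infty)$ and every $p\in(1,2)$, $\tilde{T}_n\in L^s(\mathbb{R})\cap W^{1,p}(\mathbb{R})$.
   Context: $W_n(x)=(1-x^2)_+^{1/2}U_n(x)$, where $U_n$ is the Chebyshev polynomial of the second kind and $(1-x^2)_+^{1/2}=0$ for $|x|\ge1$. The extended Chebyshev functions are $\tilde{T}_n(x)=T_n(x)$ for $|x|\le1$ and $\tilde{T}_n(x)=(x-\mathrm{sgn}(x)\sqrt{x^2-1})^n$ for $|x|>1$, where $T_n$ is the Chebyshev polynomial of the first kind. $W^{1,p}(\mathbb{R})$ is the usual Sobolev space. *)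

(* Defs.v *)
From HB Require Import structures.
From mathcomp Require Import all_boot all_order all_algebra.
From mathcomp Require Import all_classical all_reals all_analysis.
From mathcomp Require Import ring.

Set Implicit Arguments.
Unset Strict Implicit.
Unset Printing Implicit Defensive.

Import Order.TTheory GRing.Theory Num.Theory.
Import numFieldNormedType.Exports.

Local Open Scope classical_set_scope.
Local Open Scope ring_scope.

Fixpoint chebyT (R : nzRingType) (n : nat) : {poly R} :=
  match n with
  | 0 => 1
  | 1 => 'X
  | (m.+1 as k).+1 => 'X *+ 2 * chebyT R k - chebyT R m
  end.

Fixpoint chebyU (R : nzRingType) (n : nat) : {poly R} :=
  match n with
  | 0 => 1
  | 1 => 'X *+ 2
  | (m.+1 as k).+1 => 'X *+ 2 * chebyU R k - chebyU R m
  end.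

Lemma chebyT_cos (R : realType) (n : nat) (t : R) :
  (chebyT R n).[cos t] = cos (n%:R * t).
Proof.
suff: (chebyT R n).[cos t] = cos (n%:R * t) /\
      (chebyT R n.+1).[cos t] = cos (n.+1%:R * t) by case.
elim: n => [|n [IH0 IH1]]; first by rewrite /= hornerC hornerX mul0r cos0 mul1r.
split=> //.
have -> : chebyT R n.+2 = 'X *+ 2 * chebyT R n.+1 - chebyT R n by [].
rewrite hornerD hornerN hornerM hornerMn hornerX IH0 IH1.
have -> : n.+2%:R * t = n.+1%:R * t + t by ring.
have -> : n%:R * t = n.+1%:R * t - t by ring.
by rewrite cosB cosD; ring.
Qed.

Lemma chebyU_sin (R : realType) (n : nat) (t : R) :
  (chebyU R n).[cos t] * sin t = sin (n.+1%:R * t).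
Proof.
suff: (chebyU R n).[cos t] * sin t = sin (n.+1%:R * t) /\
      (chebyU R n.+1).[cos t] * sin t = sin (n.+2%:R * t) by case.
elim: n => [|n [IH0 IH1]].
  rewrite /= hornerC hornerMn hornerX !mul1r; split=> //.
  by rewrite mulr_natl mulr2n sinD; ring.
split=> //.
have -> : chebyU R n.+2 = 'X *+ 2 * chebyU R n.+1 - chebyU R n by [].
rewrite hornerD hornerN hornerM hornerMn hornerX mulrBl -mulrA IH0 IH1.
have -> : n.+3%:R * t = n.+2%:R * t + t by ring.
have -> : n.+1%:R * t = n.+2%:R * t - t by ring.
by rewrite sinB sinD; ring.
Qed.

Definition chebyW (R : realType) (n : nat) (x : R) : R :=
  Num.sqrt (Num.max (1 - x ^+ 2) 0) * (chebyU R n).[x].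

Definition chebyT_ext (R : realType) (n : nat) (x : R) : R :=
  if `|x| <= 1 then (chebyT R n).[x]
  else (x - Num.sg x * Num.sqrt (x ^+ 2 - 1)) ^+ n.

Arguments chebyW : clear implicits.
Arguments chebyT_ext : clear implicits.

Definition test_function (R : realType) : set (R -> R) :=
  [set phi | (forall (n : nat) (x : R), derivable (phi^`(n))%classic x 1) /\
             compact (closure [set x | phi x != 0])].

(* Meant for f and g locally integrable: [Rintegral] is total, and has a junk
   value when its integrand is not integrable. *)
Definition weak_derivative (R : realType) (f g : R -> R) : Prop :=
  forall phi : R -> R, test_function phi ->
    \int[lebesgue_measure]_x (f x * (phi^`())%classic x) =
    - \int[lebesgue_measure]_x (g x * phi x).

(* As in [Lfun], elements are functions rather than classes modulo equality
   almost everywhere, and "measurable" means Borel measurable: every Lebesgue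
   measurable function is almost everywhere equal to a Borel one, so this does
   not restrict the choice of the weak derivative g. *)
Definition Sobolev1 (R : realType) (p : \bar R) : set (R -> R) :=
  [set f | f \in Lfun lebesgue_measure p /\
     exists2 g : R -> R, g \in Lfun lebesgue_measure p & weak_derivative f g].

(* Main.v *)
Require Import Defs.
From mathcomp Require Import all_boot all_order all_algebra.
From mathcomp Require Import all_classical all_reals all_analysis.
From mathcomp Require Import measurable_realfun ess_sup_inf.
From mathcomp Require Import ring lra.

(** Both functions are continuous, and differentiable except at 1 and -1, where
    the derivative blows up like the inverse square root of the distance; the
    fundamental theorem of calculus still holds across such integrable
    singularities, so the pointwise derivative is the weak derivative.
    Membership in L^p is read off from domination by a function behaving like
    [||x| - 1|^(-r)] near 1 and -1 and like [|x|^(-q)] at infinity, whose p-th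
    power has the same shape with exponents [r p] and [q p], hence is integrable
    when [r p < 1 < q p].  The bounds are r = 1/2, q = 2 for both derivatives;
    r = 0, q = 2 for W_n (compactly supported); and r = 0, q = 1 for the
    extended T_n, since
    [|x| - sqrt (x^2 - 1) = 1 / (|x| + sqrt (x^2 - 1)) <= 1 / |x|]. *)

Import Order.TTheory GRing.Theory Num.Theory.
Import numFieldNormedType.Exports.

Local Open Scope classical_set_scope.
Local Open Scope ring_scope.

(** * Integrals of derivatives *)

(** [F] minus the primitive of [f] has zero derivative inside the interval and is continuous up to
    its ends, hence constant by the mean value theorem. Since [f] is only assumed integrable, it may
    blow up at [a] and [b]. *)
Lemma Rintegral_derive_oo (R : realType) (F f : R -> R) (a b : R) : a < b ->
  continuous F ->
  (forall x, a < x < b -> is_derive x 1 F (f x) /\ {for x, continuous f}) ->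
  lebesgue_measure.-integrable `[a, b] (EFin \o f) ->
  \int[lebesgue_measure]_(x in `[a, b]) f x = F b - F a.
Proof.
move=> ab cF dF fi.
pose G x := \int[lebesgue_measure]_(t in `[a, x]) f t.
have cG : {within `[a, b], continuous G}.
  exact: (parameterized_integral_continuous (ltW ab) fi).
have dFG x : x \in `]a, b[ -> is_derive x 1 (F \- G) 0.
  rewrite in_itv/= => xab; have [dFx cfx] := dF x xab.
  have /andP[ax xb] := xab.
  have [dG Gx] := continuous_FTC1_closed xb fi ax cfx.
  have dGx : is_derive x 1 G (f x) by apply: DeriveDef; rewrite -?derive1E.
  by rewrite -(subrr (f x)); exact: is_deriveB.
have cFG : {within `[a, b], continuous (F \- G)}.
  move=> x; apply: cvgB; last exact: cG.
  by apply: (continuous_subspaceT cF).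
have [c _] := MVT ab dFG cFG; rewrite mul0r => /eqP.
have Ga : G a = 0 by rewrite /G set_itv1 Rintegral_set1.
rewrite /= Ga subr0 subr_eq0 => /eqP <-.
by rewrite subKr.
Qed.

(** Induction on [s]: an exceptional point inside the interval becomes the common endpoint of two
    subintervals, where the continuous [F] has no jump to contribute. *)
Lemma Rintegral_derive_seq (R : realType) (F f : R -> R) (s : seq R) (a b : R) :
  a < b -> continuous F ->
  (forall x, a < x < b -> x \notin s ->
     is_derive x 1 F (f x) /\ {for x, continuous f}) ->
  lebesgue_measure.-integrable `[a, b] (EFin \o f) ->
  \int[lebesgue_measure]_(x in `[a, b]) f x = F b - F a.
Proof.
move=> + cF; elim: s a b => [|e s IH] a b ab dF fi.
  by apply: Rintegral_derive_oo => // x xab; exact: dF.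
(* If [e] lies outside the open interval, it excludes no point of it and the induction hypothesis
   applies at once. *)
have [/andP[ae eb]|eab] := boolP (a < e < b); last first.
  apply: IH => // x xab xs; apply: dF => //; rewrite inE negb_or xs andbT.
  by apply: contra eab => /eqP <-.
have iae : lebesgue_measure.-integrable `[a, e] (EFin \o f).
  by apply: integrableS fi => //; apply: subset_itvl; rewrite bnd_simp ltW.
have ieb : lebesgue_measure.-integrable `[e, b] (EFin \o f).
  by apply: integrableS fi => //; apply: subset_itvr; rewrite bnd_simp ltW.
have <- : F e - F a + (F b - F e) = F b - F a by ring.
rewrite -(IH a e)// -?(IH e b)//; last 2 first.
- move=> x /andP[ex xb] xs; apply: dF; first by rewrite (lt_trans ae ex).
  by rewrite inE negb_or xs (gt_eqF ex).
- move=> x /andP[ax xe] xs; apply: dF; first by rewrite ax (lt_trans xe eb).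
  by rewrite inE negb_or xs (lt_eqF xe).
rewrite -(Rintegral_itv_obnd_cbnd (r := e)); last first.
  by apply: integrableS ieb => //; exact: subset_itv_oc_cc.
rewrite -(Rintegral_itvB fi (x := e)) ?bnd_simp ?ltW//.
by rewrite addrC subrK.
Qed.

(* Monotone convergence: [k] is the derivative of a function that is bounded
   along the endpoints of the exhaustion. *)
Lemma integral_bigcup_derive_lty (R : realType) (F k : R -> R) (u v : R^nat)
    (M : R) :
  (forall n, u n < v n) -> nonincreasing_seq u -> nondecreasing_seq v ->
  (forall x, 0 <= k x) ->
  (forall n x, u n <= x <= v n ->
     is_derive x 1 F (k x) /\ {for x, continuous k}) ->
  (forall n, F (v n) - F (u n) <= M) ->
  (\int[lebesgue_measure]_(x in \bigcup_n `[u n, v n]%classic)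
     (k x)%:E < +oo)%E.
Proof.
move=> uv niu ndv k0 dF FM.
have ck n : {within `[u n, v n], continuous k}.
  apply: continuous_in_subspaceT => x; rewrite inE/= in_itv/= => xuv.
  by have [] := dF n x xuv.
have mk n : measurable_fun `[u n, v n]%classic (EFin \o k).
  apply/measurable_EFinP; apply: subspace_continuous_measurable_fun => //.
have ndI : nondecreasing_seq (fun n => `[u n, v n]%classic).
  move=> n m nm; apply/subsetPset; apply: subset_itvScc; rewrite bnd_simp.
    exact: niu.
  exact: ndv.
have mI (n : nat) : measurable `[u n, v n]%classic by [].
have k0' (n : nat) x : `[u n, v n]%classic x -> (0 <= (EFin \o k) x)%E.
  by move=> _; rewrite lee_fin.
have cvg := @ge0_nondecreasing_set_cvg_integral _ _ _ _ _
  (@lebesgue_measure R) ndI mI mk k0'.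
apply: (@le_lt_trans _ _ M%:E); last by rewrite ltry.
rewrite -(cvg_lim _ cvg)//; apply: lime_le.
  by apply/cvg_ex; eexists; exact: cvg.
apply: nearW => n.
rewrite (@continuous_FTC2 _ _ F)//.
- by rewrite -EFinB lee_fin.
- have dFn : {in `[u n, v n], forall x, derivable F x 1}.
    by move=> x; rewrite in_itv/= => /(dF n)[[]].
  split.
  + by move=> x xi; apply: dFn; apply: subset_itv_oo_cc xi.
  + apply: cvg_at_right_filter; apply: differentiable_continuous.
    by apply/derivable1_diffP/dFn; rewrite in_itv/= lexx ltW.
  + apply: cvg_at_left_filter; apply: differentiable_continuous.
    by apply/derivable1_diffP/dFn; rewrite in_itv/= lexx ltW.
- move=> x /subset_itv_oo_cc; rewrite in_itv/= => /(dF n)[[_ <-] _].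
  by rewrite derive1E.
Qed.

Lemma is_derive_affine_powR (R : realType) (c d r x : R) : c != 0 -> r != 1 ->
  0 < c * x + d ->
  is_derive x 1 (fun y => powR (c * y + d) (1 - r) / (c * (1 - r)))
    (powR (c * x + d) (- r)).
Proof.
move=> c0 r1 pos.
have dl : is_derive x 1 (fun y => c * y + d) c.
  by apply: is_derive_eq; rewrite /GRing.scale/=; ring.
have := @is_derive1_comp _ (fun z => powR z (1 - r)) (fun y => c * y + d) x _ _
  (is_derive1_powR (1 - r) pos) dl.
move=> /(is_deriveZ (c * (1 - r))^-1).
rewrite (_ : _ \*: _ = fun y => powR (c * y + d) (1 - r) / (c * (1 - r)));
  last first.
  by apply/funext => y; exact: mulrC.
move=> D; apply: is_derive_eq; rewrite /GRing.scale/=.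
have -> : 1 - r - 1 = - r by ring.
by field; rewrite c0 subr_eq0 eq_sym r1.
Qed.

Lemma continuous_affine_powR (R : realType) (c d r x : R) : 0 < c * x + d ->
  {for x, continuous (fun y => powR (c * y + d) (- r))}.
Proof.
move=> pos; apply: differentiable_continuous; apply/derivable1_diffP.
have dl : is_derive x 1 (fun y => c * y + d) c.
  by apply: is_derive_eq; rewrite /GRing.scale/=; ring.
by have [] := @is_derive1_comp _ (fun z => powR z (- r)) (fun y => c * y + d)
  x _ _ (is_derive1_powR (- r) pos) dl.
Qed.

(** * Integrability of the dominating kernel *)

Lemma measurable_fun_powR (R : realType) (f : R -> R) (r : R) :
  measurable_fun setT f -> measurable_fun setT (fun x => powR (f x) r).
Proof. by move=> mf; exact: (measurableT_comp (measurable_powR r)). Qed.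

(** The pairs [(c, d)] used below are [(-1, 1)] left of 1, [(1, -1)] right of 1 and [(1, 0)] at
    infinity. *)
Lemma integral_bigcup_affine_powR_lty (R : realType) (c d r : R) (u v : R^nat)
    (M : R) : c != 0 -> r != 1 ->
  (forall n, u n < v n) -> nonincreasing_seq u -> nondecreasing_seq v ->
  (forall n x, u n <= x <= v n -> 0 < c * x + d) ->
  (forall n, powR (c * v n + d) (1 - r) / (c * (1 - r)) -
             powR (c * u n + d) (1 - r) / (c * (1 - r)) <= M) ->
  (\int[lebesgue_measure]_(x in \bigcup_n `[u n, v n]%classic)
     (powR (c * x + d) (- r))%:E < +oo)%E.
Proof.
move=> c0 r1 uv niu ndv pos bM.
apply: (@integral_bigcup_derive_lty _
  (fun y => powR (c * y + d) (1 - r) / (c * (1 - r))) _ u v M) => //.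
  by move=> x; exact: powR_ge0.
move=> n x /pos posx; split; first exact: is_derive_affine_powR.
exact: continuous_affine_powR.
Qed.

Lemma measurable_affine_powR (R : realType) (c d r : R) (D : set R) :
  measurable_fun D (fun x => (powR (c * x + d) r)%:E).
Proof.
apply/measurable_EFinP; apply: measurable_funTS; apply: measurable_fun_powR.
by apply: measurable_funD => //; exact: mulrl_measurable.
Qed.

Lemma ge0_integral_subset_lty (R : realType) (A B : set R) (f : R -> \bar R) :
  measurable A -> measurable B -> measurable_fun B f ->
  (forall x, (0 <= f x)%E) ->
  A `<=` B -> (\int[lebesgue_measure]_(x in B) f x < +oo)%E ->
  (\int[lebesgue_measure]_(x in A) f x < +oo)%E.
Proof.
move=> mA mB mf f0 AB; apply: le_lt_trans.
by apply: ge0_subset_integral => // x _.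
Qed.

(** Gives an index at which the exhaustion by closed intervals catches a point at distance [e] from
    the singularity. *)
Lemma inv_truncn_le (R : realType) (e : R) : 0 < e ->
  ((Num.truncn e^-1).+2%:R)^-1 <= e.
Proof.
move=> e0; rewrite invf_ple ?posrE//; apply: (le_trans (ltW (truncnS_gt _))).
by rewrite ler_nat.
Qed.

Lemma integral_powR_left_lty (R : realType) (r : R) : r < 1 ->
  (\int[lebesgue_measure]_(x in `[0%R, 1%R[) (powR (-1 * x + 1) (- r))%:E
     < +oo)%E.
Proof.
move=> r1.
have invn n : 0 < (n.+2%:R : R)^-1 < 1.
  by rewrite invr_gt0 ltr0n/= invf_lt1// ltr1n.
(* With [n.+2] the right end is positive from [n = 0] on. The primitive
   [- (1 - x)^(1 - r) / (1 - r)] is at most 0 at the right end and equals [- (1 - r)^-1] at 0,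
   whence the bound. *)
apply: ge0_integral_subset_lty (integral_bigcup_affine_powR_lty _ (-1) 1 r
  (fun=> 0) (fun n => 1 - n.+2%:R^-1) (1 - r)^-1 _ _ _ _ _ _ _) => //.
- by apply: bigcup_measurable => n _; exact: measurable_itv.
- exact: measurable_affine_powR.
- by move=> x; rewrite lee_fin powR_ge0.
- move=> x /=; rewrite in_itv/= => /andP[x0 x1].
  exists (Num.truncn (1 - x)^-1) => //=; rewrite in_itv/= x0/=.
  by rewrite lerBrDl -lerBrDr inv_truncn_le// subr_gt0.
- by rewrite lt_eqF.
- by move=> n /=; move: (n.+2%:R^-1) (invn n) => t; lra.
- move=> n m nm /=; rewrite lerD2l lerN2 lef_pV2 ?posrE ?ltr0n//.
  by rewrite ler_nat.
- by move=> n x /=; move: (n.+2%:R^-1) (invn n) => t; lra.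
- move=> n; rewrite mulr0 add0r powR1.
  have s0 : 0 < 1 - r by rewrite subr_gt0.
  rewrite (mulN1r (1 - r)) invrN !mulrN opprK mul1r gerDr oppr_le0.
  by rewrite mulr_ge0 ?powR_ge0// invr_ge0 ltW.
Qed.

Lemma integral_powR_right_lty (R : realType) (r : R) : r < 1 ->
  (\int[lebesgue_measure]_(x in `]1%R, 2%R[) (powR (1 * x + -1) (- r))%:E
     < +oo)%E.
Proof.
move=> r1.
have invn n : 0 < (n.+2%:R : R)^-1 < 1.
  by rewrite invr_gt0 ltr0n/= invf_lt1// ltr1n.
(* The primitive [(x - 1)^(1 - r) / (1 - r)] is nonnegative at the left end and equals the bound at
   2. *)
apply: ge0_integral_subset_lty (integral_bigcup_affine_powR_lty _ 1 (-1) r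
  (fun n => 1 + n.+2%:R^-1) (fun=> 2) (1 - r)^-1 _ _ _ _ _ _ _) => //.
- by apply: bigcup_measurable => n _; exact: measurable_itv.
- exact: measurable_affine_powR.
- by move=> x; rewrite lee_fin powR_ge0.
- move=> x /=; rewrite in_itv/= => /andP[x0 x1].
  exists (Num.truncn (x - 1)^-1) => //=; rewrite in_itv/= (ltW x1) andbT.
  by rewrite -lerBrDl inv_truncn_le// subr_gt0.
- by rewrite lt_eqF.
- by move=> n /=; move: (n.+2%:R^-1) (invn n) => t; lra.
- move=> n m nm /=; rewrite lerD2l lef_pV2 ?posrE ?ltr0n//.
  by rewrite ler_nat.
- by move=> n x /=; move: (n.+2%:R^-1) (invn n) => t; lra.
- move=> n; have -> : 1 * 2 + -1 = 1 :> R by ring.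
  have s0 : 0 < 1 - r by rewrite subr_gt0.
  rewrite powR1 !mul1r gerBl.
  by rewrite mulr_ge0 ?powR_ge0// invr_ge0 ltW.
Qed.

Lemma integral_powR_tail_lty (R : realType) (q : R) : 1 < q ->
  (\int[lebesgue_measure]_(x in `[2%R, +oo[) (powR (1 * x + 0) (- q))%:E
     < +oo)%E.
Proof.
move=> q1.
(* The primitive [x^(1 - q) / (1 - q)] is nonpositive because [1 < q], so its increment from 2 is at
   most minus its value at 2. *)
apply: ge0_integral_subset_lty (integral_bigcup_affine_powR_lty _ 1 0 q
  (fun=> 2) (fun n => 3 + n%:R) (powR 2 (1 - q) / (q - 1)) _ _ _ _ _ _ _) => //.
- by apply: bigcup_measurable => n _; exact: measurable_itv.
- exact: measurable_affine_powR.
- by move=> x; rewrite lee_fin powR_ge0.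
- move=> x /=; rewrite in_itv/= andbT => x2.
  exists (Num.truncn x) => //=; rewrite in_itv/= x2/=.
  apply: (le_trans (ltW (truncnS_gt _))); rewrite -natr1 addrC lerD2r.
  by rewrite ler1n.
- by rewrite gt_eqF.
- by move=> n /=; move: (n%:R) (ler0n R n) => t; lra.
- by move=> n m nm /=; rewrite lerD2l ler_nat.
- by move=> n x; lra.
- move=> n; have s0 : 0 < q - 1 by rewrite subr_gt0.
  have -> : 1 - q = - (q - 1) by ring.
  rewrite !mul1r !addr0 invrN !mulrN opprK gerDr oppr_le0.
  by rewrite mulr_ge0 ?powR_ge0// invr_ge0 ltW.
Qed.

(** Removing [A] from [B] makes the union disjoint, so the pieces may overlap, as two closed
    half-lines do. *)
Lemma ge0_integral_setU_lty (R : realType) (A B : set R) (f : R -> \bar R) :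
  measurable A -> measurable B -> measurable_fun setT f ->
  (forall x, (0 <= f x)%E) ->
  (\int[lebesgue_measure]_(x in A) f x < +oo)%E ->
  (\int[lebesgue_measure]_(x in B) f x < +oo)%E ->
  (\int[lebesgue_measure]_(x in A `|` B) f x < +oo)%E.
Proof.
move=> mA mB mf f0 fA fB.
rewrite (_ : A `|` B = A `|` B `\` A); last by rewrite setDE setUIr setUv setIT.
rewrite ge0_integral_setU//.
- apply: lte_add_pinfty => //.
  apply: ge0_integral_subset_lty fB => //; first exact: measurableD.
  exact: measurable_funTS.
- exact: measurableD.
- exact: measurable_funTS.
- by apply/disj_setPS => x [Ax [_ nAx]].
Qed.

Lemma eq_integral_lty (R : realType) (D : set R) (f g : R -> R) :
  {in D, f =1 g} ->
  (\int[lebesgue_measure]_(x in D) (g x)%:E < +oo)%E ->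
  (\int[lebesgue_measure]_(x in D) (f x)%:E < +oo)%E.
Proof.
move=> fg; apply: le_lt_trans; rewrite le_eqVlt; apply/orP; left; apply/eqP.
by apply: eq_integral => x /fg ->.
Qed.

(* With MathComp's [powR], the value at [|x| = 1] is 0 unless [r = 0]. *)
Definition sing_kernel (R : realType) (r q x : R) : R :=
  if `|x| < 2 then powR `| `|x| - 1 | (- r) else powR `|x| (- q).

Lemma sing_kernel_ge0 (R : realType) (r q x : R) : 0 <= sing_kernel R r q x.
Proof. by rewrite /sing_kernel; case: ifP => _; exact: powR_ge0. Qed.

Lemma powR_sing_kernel (R : realType) (r q p x : R) :
  powR (sing_kernel R r q x) p = sing_kernel R (r * p) (q * p) x.
Proof.
by rewrite /sing_kernel; case: ifP => _; rewrite -powRrM mulNr.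
Qed.

Lemma measurable_sing_kernel (R : realType) (r q : R) :
  measurable_fun setT (sing_kernel R r q).
Proof.
apply: measurable_fun_ifT.
- by apply: measurable_fun_ltr => //; exact: normr_measurable.
- apply: measurable_fun_powR; apply: measurableT_comp => //.
  by apply: measurable_funB => //; exact: normr_measurable.
- by apply: measurable_fun_powR; exact: normr_measurable.
Qed.

Lemma integral_sing_kernel_lty (R : realType) (r q : R) : r < 1 < q ->
  (\int[lebesgue_measure]_x (sing_kernel R r q x)%:E < +oo)%E.
Proof.
move=> /andP[r1 q1].
have mK : measurable_fun setT (EFin \o sing_kernel R r q).
  by apply/measurable_EFinP; exact: measurable_sing_kernel.
have K0 x : (0 <= (sing_kernel R r q x)%:E)%E.
  by rewrite lee_fin; exact: sing_kernel_ge0.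
have half : (\int[lebesgue_measure]_(x in `[0%R, +oo[)
    (sing_kernel R r q x)%:E < +oo)%E.
  (* The singularity at 1 is split off as a null set; 2 is where the kernel changes formula. *)
  have -> : `[0%R, +oo[%classic =
      ((`[0%R, 1%R[%classic `|` [set 1]) `|`
       (`]1%R, 2%R[%classic `|` `[2%R, +oo[%classic)) :> set R.
    apply/seteqP; split => x /=; rewrite !in_itv/= ?andbT.
      move=> x0; have [x1|x1|->] := ltgtP x 1; last by left; right.
        by left; left; rewrite x0.
      by right; have [x2|x2] := ltP x 2; [left|right].
    by move=> [[/andP[]|->]|[/andP[]|]]//; lra.
  apply: ge0_integral_setU_lty => //; try exact: measurableU.
  - apply: ge0_integral_setU_lty => //; last by rewrite integral_set1.
    apply: eq_integral_lty (integral_powR_left_lty R r r1).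
    move=> x; rewrite inE/= in_itv/= => /andP[x0 x1].
    rewrite /sing_kernel ger0_norm// ifT; last by lra.
    by rewrite distrC ger0_norm ?subr_ge0 ?ltW// mulN1r addrC.
  - apply: ge0_integral_setU_lty => //.
      apply: eq_integral_lty (integral_powR_right_lty R r r1).
      move=> x; rewrite inE/= in_itv/= => /andP[x0 x1].
      rewrite /sing_kernel ger0_norm ?x1; last by lra.
      by rewrite ger0_norm ?subr_ge0 ?ltW// mul1r.
    apply: eq_integral_lty (integral_powR_tail_lty R q q1).
    move=> x; rewrite inE/= in_itv/= andbT => x2.
    rewrite /sing_kernel ger0_norm; last by lra.
    by rewrite ltNge x2/= mul1r addr0.
have -> : [set: R] = `]-oo, 0%R]%classic `|` `[0%R, +oo[%classic.
  by apply/seteqP; split => x //= _; rewrite !in_itv/= andbT;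
    apply/orP/le_total.
apply: ge0_integral_setU_lty => //.
(* The kernel is even, so reflection carries the negative half-line to the positive one. *)
apply: le_lt_trans half; rewrite ge0_integration_by_substitution0//.
rewrite le_eqVlt; apply/orP; left; apply/eqP; apply: eq_integral => x _.
by rewrite /sing_kernel normrN.
Qed.

(** * Membership in L^p by domination *)

Lemma Lfun_le_sing_kernel (R : realType) (f : R -> R) (C r q p : R) :
  measurable_fun setT f -> 0 < p -> r * p < 1 < q * p ->
  (forall x, `|f x| <= C * sing_kernel R r q x) ->
  f \in Lfun lebesgue_measure p%:E.
Proof.
move=> mf p0 rqp fC.
(* The kernel equals 1 at 0, so the domination hypothesis at 0 forces the sign of [C]. *)
have C0 : 0 <= C.
  have := le_trans (normr_ge0 _) (fC 0); rewrite /sing_kernel normr0 ltr0n/=.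
  by rewrite sub0r normrN normr1 powR1 mulr1.
rewrite inE; apply/andP; split; rewrite inE//= /finite_norm unlock.
apply: poweR_lty.
apply: (@le_lt_trans _ _ (\int[lebesgue_measure]_x
   ((powR C p)%:E * (sing_kernel R (r * p) (q * p) x)%:E))%E); last first.
  rewrite ge0_integralZl//.
  - apply: lte_mul_pinfty => //; first by rewrite lee_fin powR_ge0.
    exact: integral_sing_kernel_lty.
  - by apply/measurable_EFinP; exact: measurable_sing_kernel.
  - by move=> x _; rewrite lee_fin; exact: sing_kernel_ge0.
  - by rewrite lee_fin powR_ge0.
apply: ge0_le_integral => //.
- by move=> x _; exact: poweR_ge0.
- apply/measurable_EFinP; apply: measurable_fun_powR.
  exact: measurableT_comp.
- apply/measurable_EFinP; apply: measurable_funM => //.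
  exact: measurable_sing_kernel.
- move=> x _; rewrite -EFinM lee_fin -powR_sing_kernel.
  rewrite -powRM ?sing_kernel_ge0//; apply: ge0_ler_powR => //;
    first exact: ltW.
  by rewrite nnegrE mulr_ge0 ?sing_kernel_ge0.
Qed.

Lemma Lfun_bounded (R : realType) (f : R -> R) (C : R) :
  measurable_fun setT f -> (forall x, `|f x| <= C) ->
  f \in Lfun lebesgue_measure +oo%E.
Proof.
move=> mf fC; rewrite inE; apply/andP; split;
  rewrite inE//= /finite_norm unlock.
case: ifP => // _; apply: (@le_lt_trans _ _ C%:E); last by rewrite ltry.
by apply/ess_supP; apply: aeW => x /=; rewrite lee_fin.
Qed.

(** * Weak derivatives *)

Lemma near_norm_gt (R : realType) (M x : R) : M < `|x| ->
  \forall y \near x, M < `|y|.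
Proof. by move=> Mx; exact: (cvgr_gt _ (@norm_continuous R R x) _ Mx). Qed.

Lemma near_norm_lt (R : realType) (M x : R) : `|x| < M ->
  \forall y \near x, `|y| < M.
Proof. by move=> xM; exact: (cvgr_lt _ (@norm_continuous R R x) _ xM). Qed.

(** A compact closure of the support is bounded. Since [M < |x|] defines an open set, [phi] vanishes
    near each of its points, which kills the derivative as well. *)
Lemma test_function_vanishing (R : realType) (phi : R -> R) :
  test_function phi ->
  exists2 M : R, 0 < M &
    forall x, M < `|x| -> phi x = 0 /\ (phi^`())%classic x = 0.
Proof.
move=> [_ /compact_bounded/ex_strict_bound_gt0[M M0 supM]].
have phi0 x : M < `|x| -> phi x = 0.
  move=> Mx; apply/eqP/negPn/negP => nz.
  have clx : closure [set x | phi x != 0] x by exact: subset_closure.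
  by have /= := supM x clx; rewrite ltNge (ltW Mx).
exists M => // x Mx; split; first exact: phi0.
have zero_near : \forall y \near x, phi y = cst 0 y.
  by apply: filterS (near_norm_gt _ _ _ Mx) => y /phi0.
by rewrite derive1E (near_eq_derive _ zero_near) derive_cst.
Qed.

Lemma integrable_vanishing (d : measure_display) (T : measurableType d)
    (R : realType) (mu : {measure set T -> \bar R}) (D : set T) (f : T -> R) :
  measurable D -> (forall x, ~ D x -> f x = 0) ->
  mu.-integrable D (EFin \o f) -> mu.-integrable setT (EFin \o f).
Proof.
move=> mD f0 iD; have := (integrable_mkcond (EFin \o f) mD).1 iD.
rewrite (_ : _ \_ D = EFin \o f)//; apply/funext => x.
by rewrite patchE; case: ifPn => // /negP; rewrite inE => /f0 /= ->.
Qed.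

(** Off [s], the product [f * phi] has derivative [f * phi' + g * phi]. The integral of the latter
    is the boundary difference of [f * phi], which is 0 on an interval beyond the support;
    continuity of [f] rules out point masses at [s]. *)
Lemma weak_derivative_piecewise (R : realType) (f g : R -> R) (s : seq R) :
  continuous f ->
  (forall x, x \notin s -> is_derive x 1 f (g x) /\ {for x, continuous g}) ->
  g \in Lfun lebesgue_measure 1%E ->
  weak_derivative f g.
Proof.
move=> cf df /Lfun1_integrable ig phi tphi.
have [M M0 phiM] := test_function_vanishing _ _ tphi.
have dphi (x : R) : is_derive x 1 phi ((phi^`())%classic x).
  by apply: DeriveDef; [exact: (tphi.1 0%N x)|rewrite derive1E].
have cphi : continuous phi.
  move=> x; apply: differentiable_continuous; apply/derivable1_diffP.
  by have [] := dphi x.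
have cdphi : continuous (phi^`())%classic.
  move=> x; apply: differentiable_continuous; apply/derivable1_diffP.
  exact: (tphi.1 1%N x).
(* The margin 1 puts both endpoints in the region [M < |x|], where [phi] vanishes. *)
pose D := `[- (M + 1), M + 1]%classic : set R.
have mD : measurable D by exact: measurable_itv.
have cD : compact D by exact: segment_compact.
have offD x : ~ D x -> phi x = 0 /\ (phi^`())%classic x = 0.
  move=> nD; apply: phiM; rewrite ltNge; apply/negP => xM; apply: nD.
  by rewrite /D /= in_itv/= -ler_norml; lra.
(* Adding the two integrals requires both integrands to be integrable: the first is continuous on
   the compact [D], the second an integrable function times a bounded one. *)
have i1 : lebesgue_measure.-integrable setT
    (EFin \o (fun x => f x * (phi^`())%classic x)).
  apply: (@integrable_vanishing _ _ R lebesgue_measure D) => //.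
    by move=> x /(offD x)[_ ->]; rewrite mulr0.
  apply: continuous_compact_integrable => //; apply: continuous_subspaceT => x.
  by apply: continuousM; [exact: cf|exact: cdphi].
have i2 : lebesgue_measure.-integrable setT
    (EFin \o (fun x => g x * phi x)).
  apply: (@integrable_vanishing _ _ R lebesgue_measure D) => //.
    by move=> x /(offD x)[-> _]; rewrite mulr0.
  have igD : lebesgue_measure.-integrable D (EFin \o g).
    exact: integrableS ig.
  have mphi : measurable_fun D phi.
    by apply: measurable_funTS; exact: continuous_measurable_fun.
  have bphi : [bounded phi x | x in D].
    have /compact_bounded[N [_ Nb]] :=
      continuous_compact (continuous_subspaceT cphi) cD.
    by exists N; split; rewrite ?num_real// => y yN x Dx; apply: Nb => //;
      exists x.
  exact: (@integrableMl _ _ R lebesgue_measure D mD _ _ igD mphi bphi).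
apply/eqP; rewrite -addr_eq0 -RintegralD//; apply/eqP.
pose h x := f x * (phi^`())%classic x + g x * phi x.
have ih : lebesgue_measure.-integrable setT (EFin \o h).
  exact: (@integrableD _ _ R lebesgue_measure _ measurableT _ _ i1 i2).
transitivity (\int[lebesgue_measure]_(x in D) h x).
  rewrite [RHS]Rintegral_mkcond; apply: eq_Rintegral => x _.
  rewrite patchE; case: ifPn => // /negP; rewrite inE => /(offD x)[-> ->].
  by rewrite !mulr0 addr0.
have MM : - (M + 1) < M + 1 by lra.
rewrite (@Rintegral_derive_seq _ (f \* phi) h s)//.
- have nMb (x : R) : M < `|x| -> (f \* phi) x = 0.
    by move=> /phiM[/= -> _]; rewrite mulr0.
  by rewrite !nMb ?subrr// ?normrN ger0_norm; lra.
- by move=> x; apply: continuousM; [exact: cf|exact: cphi].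
- move=> x _ xs; have [dfx cgx] := df x xs; split.
    by apply: is_derive_eq; rewrite /h /GRing.scale/=; ring.
  apply: continuousD; apply: continuousM => //;
    by [exact: cf|exact: cdphi|exact: cphi].
- exact: integrableS ih.
Qed.

(** * The functions W_n *)

Lemma horner_bounded (R : realType) (p : {poly R}) :
  exists2 C : R, 0 <= C & forall x, `|x| <= 1 -> `|p.[x]| <= C.
Proof.
exists (\sum_(i < size p) `|p`_i|); first by apply: sumr_ge0.
move=> x x1; rewrite horner_coef; apply: le_trans (ler_norm_sum _ _ _) _.
apply: ler_sum => i _; rewrite normrM normrX.
by rewrite ler_piMr// exprn_ile1.
Qed.

Lemma powRN2V (R : realType) (x : R) : 0 <= x ->
  powR x (- 2^-1) = (Num.sqrt x)^-1.
Proof. by move=> x0; rewrite powRN powR12_sqrt. Qed.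

Lemma le_invr_sqrt (R : realType) (x y : R) : 0 < x -> x <= y ->
  (Num.sqrt y)^-1 <= (Num.sqrt x)^-1.
Proof.
move=> x0 xy; have y0 : 0 < y by exact: lt_le_trans xy.
by rewrite lef_pV2 ?posrE ?sqrtr_gt0//; exact: ler_wsqrtr.
Qed.

(** Inversion is discontinuous at 0, so measurability is read off from [powR], which agrees with the
    expression even where [f] vanishes: both are then 0. *)
Lemma measurable_invr_sqrt (R : realType) (f : R -> R) :
  (forall x, 0 <= f x) -> measurable_fun setT f ->
  measurable_fun setT (fun x => (Num.sqrt (f x))^-1).
Proof.
move=> f0 mf.
rewrite (_ : (fun x => _) = fun x => powR (f x) (- 2^-1)).
  exact: measurable_fun_powR.
by apply/funext => x; rewrite powRN2V.
Qed.

Lemma sing_kernel_half_in (R : realType) (x : R) : `|x| < 1 ->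
  sing_kernel R 2^-1 2 x = (Num.sqrt (1 - `|x|))^-1.
Proof.
move=> x1; rewrite /sing_kernel ifT; last by lra.
by rewrite distrC ger0_norm ?subr_ge0 ?ltW// powRN2V// subr_ge0 ltW.
Qed.

(** Lets the kernel absorb the bounded terms of the derivatives on []-1, 1[]. *)
Lemma sing_kernel_half_ge1 (R : realType) (x : R) : `|x| < 1 ->
  1 <= sing_kernel R 2^-1 2 x.
Proof.
move=> x1; rewrite sing_kernel_half_in// -[leLHS]invr1 -[X in X^-1 <= _]sqrtr1.
by apply: le_invr_sqrt; have := normr_ge0 x; lra.
Qed.

Lemma Sobolev1_of_bounds (R : realType) (f g : R -> R) (s : seq R) (C p : R) :
  1 <= p < 2 -> f \in Lfun lebesgue_measure p%:E ->
  continuous f ->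
  (forall x, x \notin s -> is_derive x 1 f (g x) /\ {for x, continuous g}) ->
  measurable_fun setT g ->
  (forall x, `|g x| <= C * sing_kernel R 2^-1 2 x) ->
  Sobolev1 p%:E f.
Proof.
move=> p12 fp cf dg mg gC; split => //.
(* Used at [p] for the Sobolev condition and at 1 for the weak derivative. The upper limit 2 comes
   from the singularity: [2^-1 * q < 1]. *)
have gL q : 1 <= q < 2 -> g \in Lfun lebesgue_measure q%:E.
  by move=> q12; apply: Lfun_le_sing_kernel gC => //; lra.
exists g; first exact: gL.
by apply: weak_derivative_piecewise cf dg _; apply: gL; lra.
Qed.

(* Since [0^-1 = 0], this is 0 when [1 <= |x|], including at [x = 1, -1]. *)
Definition chebyW_deriv (R : realType) (n : nat) (x : R) : R :=
  Num.sqrt (Num.max (1 - x ^+ 2) 0) * (chebyU R n)^`().[x] -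
  x * (chebyU R n).[x] * (Num.sqrt (Num.max (1 - x ^+ 2) 0))^-1.

Lemma sqr_normr_lt1 (R : realType) (x : R) : (`|x| < 1) = (x ^+ 2 < 1).
Proof. by rewrite -[in RHS]real_normK ?num_real// expr_lt1. Qed.

Lemma continuous_semicircle (R : realType) :
  continuous (fun x : R => Num.sqrt (Num.max (1 - x ^+ 2) 0)).
Proof.
move=> x; apply: continuous_comp; last exact: sqrt_continuous.
apply: (@continuous_max R R (fun y => 1 - y ^+ 2) (fun=> 0));
  last exact: cst_continuous.
by apply: continuousB; [exact: cst_continuous|exact: exprn_continuous].
Qed.

Lemma semicircle_in (R : realType) (x : R) : `|x| < 1 ->
  Num.max (1 - x ^+ 2) 0 = 1 - x ^+ 2.
Proof. by rewrite sqr_normr_lt1 => x1; rewrite max_l// subr_ge0 ltW. Qed.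

Lemma semicircle_out (R : realType) (x : R) : 1 <= `|x| ->
  Num.max (1 - x ^+ 2) 0 = 0.
Proof.
by rewrite leNgt sqr_normr_lt1 -leNgt => x1; rewrite max_r// subr_le0.
Qed.

Lemma semicircle_le1 (R : realType) (x : R) :
  Num.sqrt (Num.max (1 - x ^+ 2) 0) <= 1.
Proof.
rewrite -[leRHS]sqrtr1 ler_wsqrtr// ge_max ler01 andbT.
by rewrite gerBl sqr_ge0.
Qed.

Lemma chebyW_out (R : realType) (n : nat) (x : R) : 1 <= `|x| ->
  chebyW R n x = 0.
Proof. by move=> x1; rewrite /chebyW semicircle_out// sqrtr0 mul0r. Qed.

Lemma chebyW_deriv_out (R : realType) (n : nat) (x : R) : 1 <= `|x| ->
  chebyW_deriv R n x = 0.
Proof.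
by move=> x1; rewrite /chebyW_deriv semicircle_out// sqrtr0 invr0 mulr0 mul0r
  subrr.
Qed.

Lemma continuous_chebyW (R : realType) (n : nat) : continuous (chebyW R n).
Proof.
move=> x.
have cU : {for x, continuous (horner (chebyU R n))} by exact: continuous_horner.
exact: (continuousM (continuous_semicircle R x) cU).
Qed.

Lemma is_derive_chebyW (R : realType) (n : nat) (x : R) : `|x| != 1 ->
  is_derive x 1 (chebyW R n) (chebyW_deriv R n x).
Proof.
rewrite neq_lt => /orP[x1|x1]; last first.
  rewrite chebyW_deriv_out ?ltW//.
  apply: near_eq_is_derive (is_derive_cst (0 : R) x 1).
  by apply: filterS (near_norm_gt _ _ _ x1) => y y1; rewrite chebyW_out ?ltW.
have pos : 0 < 1 - x ^+ 2 by rewrite subr_gt0 -sqr_normr_lt1.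
pose h y : R := Num.sqrt (1 - y ^+ 2) * (chebyU R n).[y].
apply: (@near_eq_is_derive _ _ _ h).
  by apply: filterS (near_norm_lt _ _ _ x1) => y y1;
    rewrite /h /chebyW semicircle_in.
have dq : is_derive x 1 (fun y : R => 1 - y ^+ 2) (- (2 * x)).
  by apply: is_derive_eq; rewrite /GRing.scale/=; ring.
have ds := @is_derive1_comp _ Num.sqrt (fun y : R => 1 - y ^+ 2) x _ _
  (is_derive1_sqrt pos) dq.
have := @is_deriveM _ _ (Num.sqrt \o (fun y : R => 1 - y ^+ 2))
  (horner (chebyU R n)) x 1 _ _ ds (is_derive_poly (chebyU R n) x).
move=> D; apply: is_derive_eq;
  rewrite /chebyW_deriv semicircle_in// /GRing.scale/=.
by field; rewrite gt_eqF// sqrtr_gt0.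
Qed.

Lemma continuous_chebyW_deriv (R : realType) (n : nat) (x : R) : `|x| != 1 ->
  {for x, continuous (chebyW_deriv R n)}.
Proof.
rewrite neq_lt => /orP[x1|x1]; last first.
  apply: (near_cst_continuous 0).
  by apply: filterS (near_norm_gt _ _ _ x1) => y y1;
    rewrite chebyW_deriv_out ?ltW.
have cs := continuous_semicircle R.
have cV : {for x, continuous (fun y : R =>
  (Num.sqrt (Num.max (1 - y ^+ 2) 0))^-1)}.
  apply: continuousV; last exact: cs.
  by rewrite semicircle_in// gt_eqF// sqrtr_gt0 subr_gt0 -sqr_normr_lt1.
have cU' : {for x, continuous (horner (chebyU R n)^`())}.
  exact: continuous_horner.
have cxU : {for x, continuous (fun y : R => y * (chebyU R n).[y])}.
  by apply: continuousM; [exact: cvg_id|exact: continuous_horner].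
exact: (continuousB (continuousM (cs x) cU') (continuousM cxU cV)).
Qed.

Lemma measurable_chebyW_deriv (R : realType) (n : nat) :
  measurable_fun setT (chebyW_deriv R n).
Proof.
have mcont (h : R -> R) : continuous h -> measurable_fun setT h.
  exact: continuous_measurable_fun.
apply: measurable_funB; apply: measurable_funM.
- by apply: mcont; exact: continuous_semicircle.
- by apply: mcont; exact: continuous_horner.
- by apply: measurable_funM => //; apply: mcont; exact: continuous_horner.
- apply: measurable_invr_sqrt => [x|]; first by rewrite le_max lexx orbT.
  by apply: measurable_maxr => //; apply: measurable_funB.
Qed.

(** The kernel bound serves finite exponents, the uniform bound serves [s = +oo]. *)
Lemma chebyW_le (R : realType) (n : nat) :
  exists C, forall x,
    `|chebyW R n x| <= C * sing_kernel R 0 2 x /\ `|chebyW R n x| <= C.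
Proof.
have [C C0 UC] := horner_bounded R (chebyU R n).
exists C => x; have [x1|x1] := leP 1 `|x|.
  by rewrite chebyW_out// normr0; split=> //; rewrite mulr_ge0 ?sing_kernel_ge0.
have -> : sing_kernel R 0 2 x = 1.
  by rewrite /sing_kernel ifT ?oppr0 ?powRr0//; lra.
suff le : `|chebyW R n x| <= C by rewrite mulr1.
rewrite /chebyW normrM -[leRHS]mul1r ler_pM//; last exact/UC/ltW.
by rewrite ger0_norm ?sqrtr_ge0// semicircle_le1.
Qed.

Lemma chebyW_deriv_le (R : realType) (n : nat) :
  exists C, forall x, `|chebyW_deriv R n x| <= C * sing_kernel R 2^-1 2 x.
Proof.
have [C C0 UC] := horner_bounded R (chebyU R n).
have [C' C'0 UC'] := horner_bounded R (chebyU R n)^`().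
exists (C' + C) => x; have [x1|x1] := leP 1 `|x|.
  by rewrite chebyW_deriv_out// normr0 mulr_ge0 ?sing_kernel_ge0// addr_ge0.
rewrite mulrDl; apply: le_trans (ler_normB _ _) _; apply: lerD.
  apply: (@le_trans _ _ C'); last by rewrite ler_peMr ?sing_kernel_half_ge1.
  rewrite normrM -[leRHS]mul1r ler_pM//; last exact/UC'/ltW.
  by rewrite ger0_norm ?sqrtr_ge0// semicircle_le1.
rewrite normrM ler_pM//.
  by rewrite normrM -[leRHS]mul1r ler_pM//; [exact: ltW|exact/UC/ltW].
rewrite semicircle_in// ger0_norm ?invr_ge0 ?sqrtr_ge0// sing_kernel_half_in//.
(* Here [1 - |x| <= 1 - x^2], since [|x|^2 <= |x|]. *)
apply: le_invr_sqrt; first by rewrite subr_gt0.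
rewrite lerD2l lerN2 -real_normK ?num_real// expr2.
by rewrite ler_piMr// ltW.
Qed.

(** * The extended Chebyshev functions *)

(** The values at 1 and -1, obtained from the angles 0 and [pi], are what glues the polynomial to
    the outer branches. *)
Lemma chebyT_1 (R : realType) (n : nat) : (chebyT R n).[1] = 1.
Proof. by rewrite -cos0 chebyT_cos mulr0 cos0. Qed.

Lemma chebyT_N1 (R : realType) (n : nat) : (chebyT R n).[-1] = (-1) ^+ n.
Proof.
rewrite -[X in _.[X]]cospi chebyT_cos; elim: n => [|n IH];
  first by rewrite mul0r cos0.
by rewrite -natr1 mulrDl mul1r cosDpi IH exprS mulN1r.
Qed.

(* Since [0^-1 = 0], this is 0 at [x = 1, -1]. *)
Definition chebyT_ext_deriv (R : realType) (n : nat) (x : R) : R :=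
  if `|x| < 1 then (chebyT R n)^`().[x]
  else - (n%:R * Num.sg x * (x - Num.sg x * Num.sqrt (x ^+ 2 - 1)) ^+ n *
          (Num.sqrt (x ^+ 2 - 1))^-1).

(* For [|x| > 1], the root of [w + 1 / w = 2 |x|] in ]0, 1[. *)
Definition joukowski_inv (R : realType) (x : R) : R :=
  Num.max `|x| 1 - Num.sqrt (Num.max (x ^+ 2 - 1) 0).

Lemma joukowski_inv_in (R : realType) (x : R) : `|x| <= 1 ->
  joukowski_inv R x = 1.
Proof.
move=> x1; rewrite /joukowski_inv max_r// max_r; first by rewrite sqrtr0 subr0.
by rewrite subr_le0 -real_normK ?num_real// exprn_ile1.
Qed.

Lemma sqr_sub1_gt0 (R : realType) (x : R) : 1 < `|x| -> 0 < x ^+ 2 - 1.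
Proof. by move=> x1; rewrite subr_gt0 -real_normK ?num_real// exprn_egt1. Qed.

Lemma joukowski_inv_out (R : realType) (x : R) : 1 < `|x| ->
  x - Num.sg x * Num.sqrt (x ^+ 2 - 1) = Num.sg x * joukowski_inv R x.
Proof.
move=> x1; rewrite /joukowski_inv (max_l (ltW x1)).
rewrite (max_l (ltW (sqr_sub1_gt0 _ _ x1))).
by rewrite mulrBr -numEsg.
Qed.

Lemma joukowski_inv_ge0 (R : realType) (x : R) : 1 < `|x| ->
  0 <= joukowski_inv R x.
Proof.
move=> x1; rewrite /joukowski_inv (max_l (ltW x1)).
rewrite (max_l (ltW (sqr_sub1_gt0 _ _ x1))).
rewrite subr_ge0 -[leRHS]ger0_norm// -sqrtr_sqr ler_wsqrtr//.
by rewrite real_normK ?num_real// gerBl.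
Qed.

Lemma joukowski_inv_le (R : realType) (x : R) : 1 < `|x| ->
  joukowski_inv R x <= `|x|^-1.
Proof.
move=> x1; have := joukowski_inv_ge0 _ _ x1.
rewrite /joukowski_inv (max_l (ltW x1)) (max_l (ltW (sqr_sub1_gt0 _ _ x1))).
set r := Num.sqrt _ => xr.
have r0 : 0 <= r by exact: sqrtr_ge0.
have r2 : r ^+ 2 = `|x| ^+ 2 - 1.
  by rewrite sqr_sqrtr ?ltW ?sqr_sub1_gt0// real_normK ?num_real.
rewrite -[leRHS]mul1r ler_pdivlMr; last by lra.
(* Substituting [1 = |x|^2 - r^2], the difference becomes [r * (|x| - r)], a product of nonnegative
   factors. *)
by rewrite -subr_ge0; nra.
Qed.

(* Free of case distinctions on [x], hence continuous also at 1 and -1. *)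
Lemma chebyT_extE (R : realType) (n : nat) (x : R) :
  chebyT_ext R n x =
  (chebyT R n).[Num.max (-1) (Num.min x 1)] * joukowski_inv R x ^+ n.
Proof.
rewrite /chebyT_ext; case: ifPn => [x1|]; last rewrite -ltNge => x1.
  rewrite joukowski_inv_in// expr1n mulr1; move: x1;
    rewrite ler_norml => /andP[? ?].
  by rewrite min_l// max_r.
(* Outside [[-1, 1]] the clamped argument is the sign of [x], where the polynomial takes the value
   [Num.sg x ^+ n]. *)
rewrite joukowski_inv_out// exprMn; congr (_ * _).
move: x1; rewrite ltr_normr => /orP[x1|x1].
  by rewrite min_r ?ltW// max_r ?chebyT_1 ?gtr0_sg ?expr1n//; lra.
rewrite min_l; last by lra.
rewrite max_l; last by lra.
by rewrite chebyT_N1 ltr0_sg//; lra.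
Qed.

Lemma continuous_joukowski_inv (R : realType) : continuous (joukowski_inv R).
Proof.
move=> x.
have c1 : {for x, continuous (fun y : R => Num.max `|y| 1)}.
  by apply: (@continuous_max R R);
    [exact: norm_continuous|exact: cst_continuous].
have c2 : {for x, continuous (fun y : R => Num.sqrt (Num.max (y ^+ 2 - 1) 0))}.
  apply: continuous_comp; last exact: sqrt_continuous.
  apply: (@continuous_max R R (fun y => y ^+ 2 - 1) (fun=> 0));
    last exact: cst_continuous.
  by apply: continuousB; [exact: exprn_continuous|exact: cst_continuous].
exact: (continuousB c1 c2).
Qed.

Lemma continuous_chebyT_ext (R : realType) (n : nat) :
  continuous (chebyT_ext R n).
Proof.
rewrite (_ : chebyT_ext R n = fun x =>
  (chebyT R n).[Num.max (-1) (Num.min x 1)] *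
  joukowski_inv R x ^+ n); last by apply/funext => x; exact: chebyT_extE.
move=> x.
have c1 : {for x, continuous (fun x : R =>
  (chebyT R n).[Num.max (-1) (Num.min x 1)])}.
  apply: (@continuous_comp _ _ _ (fun x : R => Num.max (-1) (Num.min x 1)));
    last exact: continuous_horner.
  apply: (@continuous_max R R (fun=> -1) (fun y => Num.min y 1));
    first exact: cst_continuous.
  by apply: (@continuous_min R R (fun y => y) (fun=> 1));
    [exact: cvg_id|exact: cst_continuous].
have c2 : {for x, continuous (fun x : R => joukowski_inv R x ^+ n)}.
  apply: (@continuous_comp _ _ _ (joukowski_inv R) (fun y => y ^+ n));
    last exact: exprn_continuous.
  exact: (continuous_joukowski_inv R x).
exact: (continuousM c1 c2).
Qed.

(** Allows the sign to be frozen to a constant in local arguments away from 0. *)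
Lemma near_sg (R : realType) (x : R) : x != 0 ->
  \forall y \near x, Num.sg y = Num.sg x.
Proof.
rewrite neq_lt => /orP[x0|x0].
  have : \forall y \near x, y < 0 by exact: (cvgr_lt _ cvg_id _ x0).
  by apply: filterS => y y0; rewrite !ltr0_sg.
have : \forall y \near x, 0 < y by exact: (cvgr_gt _ cvg_id _ x0).
by apply: filterS => y y0; rewrite !gtr0_sg.
Qed.

Lemma is_derive_sqrt_sqrB1 (R : realType) (x : R) : 1 < `|x| ->
  is_derive x 1 (fun y : R => Num.sqrt (y ^+ 2 - 1))
    (x / Num.sqrt (x ^+ 2 - 1)).
Proof.
move=> x1; have pos := sqr_sub1_gt0 _ _ x1.
have dq : is_derive x 1 (fun y : R => y ^+ 2 - 1) (2 * x).
  by apply: is_derive_eq; rewrite /GRing.scale/=; ring.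
have ds := @is_derive1_comp _ Num.sqrt (fun y : R => y ^+ 2 - 1) x _ _
  (is_derive1_sqrt pos) dq.
apply: is_derive_eq; field.
by rewrite gt_eqF// sqrtr_gt0.
Qed.

(** With [e] the sign of [x] and [r = sqrt (x^2 - 1)], the base [u = x - e * r] satisfies
    [u' = - e * u / r] because [e^2 = 1]. Hence the derivative of [u^n] is again a multiple of
    [u^n]. *)
Lemma is_derive_chebyT_ext_out (R : realType) (n : nat) (x : R) : 1 < `|x| ->
  is_derive x 1 (chebyT_ext R n) (chebyT_ext_deriv R n x).
Proof.
move=> x1; have pos := sqr_sub1_gt0 _ _ x1.
have x0 : x != 0 by rewrite -normr_gt0 (lt_trans _ x1).
rewrite /chebyT_ext_deriv ltNge (ltW x1)/=.
have near_ext : \forall y \near x,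
    (y - Num.sg x * Num.sqrt (y ^+ 2 - 1)) ^+ n = chebyT_ext R n y.
  near=> y; have y1 : 1 < `|y| by near: y; exact: near_norm_gt.
  have sy : Num.sg y = Num.sg x by near: y; exact: near_sg.
  by rewrite /chebyT_ext leNgt y1/= sy.
apply: near_eq_is_derive near_ext _.
set e := Num.sg x; have e2 : e ^+ 2 = 1 by rewrite sqr_sg x0.
have ds := is_derive_sqrt_sqrB1 _ _ x1.
set r := Num.sqrt (x ^+ 2 - 1) in ds *.
have r0 : r != 0 by rewrite gt_eqF// sqrtr_gt0.
have du : is_derive x 1 (fun y : R => y - e * Num.sqrt (y ^+ 2 - 1))
    (- e * (x - e * r) / r).
  have -> : - e * (x - e * r) / r = 1 - e * (x / r).
    have -> : - e * (x - e * r) = e ^+ 2 * r - e * x by ring.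
    by rewrite e2; field.
  by apply: is_deriveB; apply: is_deriveZ.
(* The power rule lowers the exponent, so the constant case 0 is treated apart. *)
case: n => [|n].
  by rewrite !mul0r oppr0; exact: is_derive_cst.
have dun := is_deriveX n.+1 du; rewrite exprfctE in dun.
apply: (@is_derive_eq _ _ _ _ _ _ _ _ dun); rewrite /GRing.scale/= -/r exprS.
by field.
Unshelve. all: by end_near. Qed.

Lemma is_derive_chebyT_ext (R : realType) (n : nat) (x : R) : `|x| != 1 ->
  is_derive x 1 (chebyT_ext R n) (chebyT_ext_deriv R n x).
Proof.
rewrite neq_lt => /orP[x1|]; last exact: is_derive_chebyT_ext_out.
rewrite /chebyT_ext_deriv x1.
apply: near_eq_is_derive (is_derive_poly (chebyT R n) x).
by apply: filterS (near_norm_lt _ _ _ x1) => y y1; rewrite /chebyT_ext ltW.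
Qed.

Lemma continuous_chebyT_ext_deriv (R : realType) (n : nat) (x : R) :
  `|x| != 1 ->
  {for x, continuous (chebyT_ext_deriv R n)}.
Proof.
rewrite neq_lt => /orP[x1|x1].
  have cT : {for x, continuous (horner (chebyT R n)^`())}.
    exact: continuous_horner.
  rewrite /prop_for /continuous_at {2}/chebyT_ext_deriv x1.
  apply: cvg_trans cT; apply: near_eq_cvg.
  by apply: filterS (near_norm_lt _ _ _ x1) => y y1;
    rewrite /chebyT_ext_deriv y1.
have pos := sqr_sub1_gt0 _ _ x1.
have x0 : x != 0 by rewrite -normr_gt0 (lt_trans _ x1).
(* With the sign frozen, the derivative is a multiple of [chebyT_ext] itself, already known to be
   continuous, divided by a nonvanishing root. *)
pose h y : R := - (n%:R * Num.sg x) * chebyT_ext R n y *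
  (Num.sqrt (y ^+ 2 - 1))^-1.
have near_h : \forall y \near x, h y = chebyT_ext_deriv R n y.
  near=> y; have y1 : 1 < `|y| by near: y; exact: near_norm_gt.
  have sy : Num.sg y = Num.sg x by near: y; exact: near_sg.
  rewrite /h /chebyT_ext_deriv ltNge (ltW y1)/= /chebyT_ext leNgt y1/= sy.
  by rewrite !mulNr.
rewrite /prop_for /continuous_at -(nbhs_singleton near_h).
apply: cvg_trans (near_eq_cvg near_h) _.
have cs : {for x, continuous (fun y : R => Num.sqrt (y ^+ 2 - 1))}.
  apply: differentiable_continuous; apply/derivable1_diffP.
  by have [] := is_derive_sqrt_sqrB1 _ _ x1.
have cV : {for x, continuous (fun y : R => (Num.sqrt (y ^+ 2 - 1))^-1)}.
  by apply: continuousV => //; rewrite gt_eqF// sqrtr_gt0.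
have cT : {for x, continuous (fun y : R =>
  - (n%:R * Num.sg x) * chebyT_ext R n y)}.
  by apply: continuousM; [exact: cst_continuous|exact: continuous_chebyT_ext].
exact: (continuousM cT cV).
Unshelve. all: by end_near. Qed.

Lemma measurable_sg (R : realType) : measurable_fun setT (@Num.sg R).
Proof.
rewrite (_ : Num.sg = fun x : R =>
  if 0 < x then 1 else if x < 0 then -1 else 0).
  apply: measurable_fun_ifT => //; first exact: measurable_fun_ltr.
  by apply: measurable_fun_ifT => //; exact: measurable_fun_ltr.
by apply/funext => x; have [/gtr0_sg|/ltr0_sg|<-] := ltgtP 0 x; rewrite ?sgr0.
Qed.

Lemma measurable_chebyT_ext_deriv (R : realType) (n : nat) :
  measurable_fun setT (chebyT_ext_deriv R n).
Proof.
have msg := measurable_sg R.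
have msq : measurable_fun setT (fun x : R => x ^+ 2 - 1).
  exact: measurable_funB.
have mN (x : R) : x ^+ 2 - 1 <= 0 -> Num.sqrt (x ^+ 2 - 1) = 0.
  exact: ler0_sqrtr.
(* Since [Num.sqrt] is 0 on negative numbers, truncating the radicand changes nothing and makes it
   nonnegative everywhere. *)
have sqrt_max (x : R) : Num.sqrt (x ^+ 2 - 1) =
    Num.sqrt (Num.max (x ^+ 2 - 1) 0).
  by have [/mN ->|] := leP (x ^+ 2 - 1) 0; rewrite ?sqrtr0.
have mr : measurable_fun setT (fun x : R => (Num.sqrt (x ^+ 2 - 1))^-1).
  under eq_fun do rewrite sqrt_max.
  apply: measurable_invr_sqrt => [x|]; first by rewrite le_max lexx orbT.
  exact: measurable_maxr.
apply: measurable_fun_ifT.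
- by apply: measurable_fun_ltr => //; exact: normr_measurable.
- by apply: continuous_measurable_fun; exact: continuous_horner.
apply: measurableT_comp => //; apply: measurable_funM => //.
apply: measurable_funM; first exact: measurable_funM.
apply: measurable_funX; apply: measurable_funB => //;
  apply: measurable_funM => //.
apply: continuous_measurable_fun => x; apply: continuous_comp;
  last exact: sqrt_continuous.
by apply: continuousB; [exact: exprn_continuous|exact: cst_continuous].
Qed.

(** The modulus is [w^n] with [0 <= w <= 1 / |x| <= 1], and [w^n <= w] once [1 <= n]. For [n = 0]
    the extended function is the constant 1, which does not decay. *)
Lemma norm_chebyT_ext_out (R : realType) (n : nat) (x : R) :
  (1 <= n)%N -> 1 < `|x| ->
  `|(x - Num.sg x * Num.sqrt (x ^+ 2 - 1)) ^+ n| <= `|x|^-1.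
Proof.
move=> n1 x1; have x0 : x != 0 by rewrite -normr_gt0 (lt_trans _ x1).
rewrite joukowski_inv_out// normrX normrM normr_sg x0 mul1r.
rewrite ger0_norm ?joukowski_inv_ge0//.
have le1 : joukowski_inv R x <= 1.
  by rewrite (le_trans (joukowski_inv_le _ _ x1))// invf_le1// ?ltW//
    (lt_trans _ x1).
apply: le_trans (joukowski_inv_le _ _ x1).
by rewrite -[leRHS]expr1 ler_wiXn2l// joukowski_inv_ge0.
Qed.

Lemma chebyT_ext_le (R : realType) (n : nat) : (1 <= n)%N ->
  exists C, forall x, `|chebyT_ext R n x| <= C * sing_kernel R 0 1 x.
Proof.
move=> n1; have [C C0 TC] := horner_bounded R (chebyT R n).
(* [C] covers [[-1, 1]] and the summand 1 covers the outside. The exponent 0 makes the kernel equal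
   to 1 whenever [|x| < 2], also at [|x| = 1]. *)
exists (C + 1) => x; rewrite /sing_kernel oppr0 powRr0.
rewrite /chebyT_ext; case: ifPn => [x1|]; last rewrite -ltNge => x1.
  by rewrite ifT ?mulr1; [have := TC x x1; lra|lra].
apply: le_trans (norm_chebyT_ext_out _ _ _ n1 x1) _.
have xi1 : `|x|^-1 <= 1 by rewrite invf_le1// ?ltW// (lt_trans _ x1).
case: ifPn => _; first by rewrite mulr1; lra.
by rewrite powR_inv1// ler_peMl ?invr_ge0//; lra.
Qed.

(** [C] bounds the polynomial derivative inside. Outside, the modulus is at most
    [n / (|x| * sqrt (x^2 - 1))]; the root is at least [sqrt (|x| - 1)] near the singularity and at
    least [|x| / 2] from 2 on, which is the source of the factor 2. *)
Lemma chebyT_ext_deriv_le (R : realType) (n : nat) : (1 <= n)%N ->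
  exists C, forall x, `|chebyT_ext_deriv R n x| <= C * sing_kernel R 2^-1 2 x.
Proof.
move=> n1; have [C C0 TC] := horner_bounded R (chebyT R n)^`().
exists (C + n%:R * 2) => x; have K0 := sing_kernel_ge0 R 2^-1 2 x.
have n0 : 0 <= n%:R :> R by [].
rewrite /chebyT_ext_deriv; case: ifPn => [x1|]; last rewrite -leNgt => x1.
  apply: le_trans (TC _ (ltW x1)) _; apply: (@le_trans _ _ (C + n%:R * 2));
    first by lra.
  by rewrite ler_peMr ?sing_kernel_half_ge1//; lra.
(* At [|x| = 1] the inverse of the vanishing root is 0, so the left side is 0. *)
move: x1; rewrite le_eqVlt => /predU1P[x1|x1].
  have -> : x ^+ 2 - 1 = 0.
    by rewrite -real_normK ?num_real// -x1 expr1n subrr.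
  by rewrite sqrtr0 invr0 mulr0 oppr0 normr0 mulr_ge0//; lra.
have x0 : x != 0 by rewrite -normr_gt0 (lt_trans _ x1).
rewrite normrN !normrM normr_sg x0 mulr1 normr_nat.
have pos := sqr_sub1_gt0 _ _ x1.
rewrite (@ger0_norm _ (_^-1)) ?invr_ge0 ?sqrtr_ge0//.
apply: (@le_trans _ _ (n%:R * 2 * sing_kernel R 2^-1 2 x)); last first.
  by rewrite ler_wpM2r//; lra.
rewrite -!mulrA ler_wpM2l//.
apply: (@le_trans _ _ (`|x|^-1 * (Num.sqrt (x ^+ 2 - 1))^-1)).
  by rewrite ler_wpM2r ?invr_ge0 ?sqrtr_ge0// norm_chebyT_ext_out.
rewrite /sing_kernel; case: ifPn => [x2|]; last rewrite -leNgt => x2.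
  apply: ler_pM; rewrite ?invr_ge0 ?sqrtr_ge0//.
    by rewrite (@le_trans _ _ 1) ?ler1n// invf_le1// ?ltW// (lt_trans _ x1).
  have x1' : 0 <= `|x| - 1 by rewrite subr_ge0 ltW.
  rewrite ger0_norm// powRN2V//.
  apply: le_invr_sqrt; first by rewrite subr_gt0.
  by rewrite lerD2r -real_normK ?num_real// expr2 ler_peMr// ltW.
rewrite powR_invn// exprS expr1 invfM mulrCA ler_wpM2l ?invr_ge0//.
(* Squared, this says [1 <= 3 * x^2 / 4], which holds for [2 <= |x|]. *)
have s2 : `|x| / 2 <= Num.sqrt (x ^+ 2 - 1).
  rewrite -[leLHS]ger0_norm ?divr_ge0// -sqrtr_sqr ler_wsqrtr//.
  by rewrite -[x ^+ 2]real_normK ?num_real//; nra.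
rewrite -[leRHS]invrK lef_pV2 ?posrE ?sqrtr_gt0//; last first.
  by rewrite invr_gt0 mulr_gt0// invr_gt0; lra.
by rewrite invfM invrK mulrC.
Qed.

Theorem lemma3p1 (R : realType) :
  (forall (n : nat) (s : \bar R) (p : R),
      (1 <= s)%E -> 1 <= p < 2 ->
      chebyW R n \in Lfun lebesgue_measure s /\ Sobolev1 p%:E (chebyW R n)) /\
  (forall (n : nat) (s p : R),
      (1 <= n)%N -> 1 < s -> 1 < p < 2 ->
      chebyT_ext R n \in Lfun lebesgue_measure s%:E /\
      Sobolev1 p%:E (chebyT_ext R n)).
Proof.
have norm_neq1 (x : R) : x \notin [:: 1; -1] -> `|x| != 1.
  by rewrite !inE; apply: contra; rewrite eqr_norml => /andP[].
split=> [n s p s1 p12|n s p n1 s1 p12].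
- have [C WC] := chebyW_le R n; have [C' WC'] := chebyW_deriv_le R n.
  have cW := continuous_chebyW R n.
  have mW : measurable_fun setT (chebyW R n).
    exact: continuous_measurable_fun.
  (* Decay exponent 2 in the kernel allows [t = 1], since [1 < 2 * t]. *)
  have WL (t : R) : 1 <= t -> chebyW R n \in Lfun lebesgue_measure t%:E.
    move=> t1; apply: (@Lfun_le_sing_kernel _ _ C 0 2) => //; [lra|lra|].
    by move=> x; have [] := WC x.
  split.
    case: s s1 => [s||]//; first by rewrite lee_fin; exact: WL.
    by move=> _; apply: (@Lfun_bounded _ _ C) => // x; have [] := WC x.
  apply: (@Sobolev1_of_bounds _ _ (chebyW_deriv R n) [:: 1; -1] C') => //.
  + by apply: WL; lra.
  + move=> x /norm_neq1 x1; split; first exact: is_derive_chebyW.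
    exact: continuous_chebyW_deriv.
  + exact: measurable_chebyW_deriv.
- have [C TC] := chebyT_ext_le R n n1.
  have [C' TC'] := chebyT_ext_deriv_le R n n1.
  have cT := continuous_chebyT_ext R n.
  have mT : measurable_fun setT (chebyT_ext R n).
    exact: continuous_measurable_fun.
  (* The decay exponent is only 1 here, so integrability at infinity asks for [1 < t]; this is what
     excludes the exponent 1 for [s] and [p]. *)
  have TL (t : R) : 1 < t -> chebyT_ext R n \in Lfun lebesgue_measure t%:E.
    by move=> t1; apply: (@Lfun_le_sing_kernel _ _ C 0 1) => //; lra.
  split; first exact: TL.
  apply: (@Sobolev1_of_bounds _ _ (chebyT_ext_deriv R n) [:: 1; -1] C') => //.
  + by lra.
  + by apply: TL; lra.
  + move=> x /norm_neq1 x1; split; first exact: is_derive_chebyT_ext.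
    exact: continuous_chebyT_ext_deriv.
  + exact: measurable_chebyT_ext_deriv.
Qed.
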